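(* Let $X$ be a real Banach space, let $\sum_i x_i$ be a series in $X$ and let $\theta=(k_r)$ be a lacunary sequence. The following conditions are equivalent: (1) $\sum_i x_i$ is a weakly unconditionally Cauchy series (wuC). (2) $S_{S_\theta}(\sum_i x_i)$ is a complete space (with the supremum norm). (3) $c_0\subset S_{S_\theta}(\sum_i x_i)$.
   Context: A lacunary sequence is a (strictly) increasing sequence $\theta=(k_r)_{r\ge 0}$ of natural numbers with $k_0=0$ and $h_r=k_r-k_{r-1}\to+\infty$ as $r\to\infty$. For $r\ge 1$ put $I_r=(k_{r-1},k_r]$ (the set of integers $k$ with $k_{r-1}<k\le k_r$). A sequence $(s_k)$ in $X$ is $S_\theta$-convergent (lacunary statistically convergent) to $L\in X$ if for every $\varepsilon>0$, $\lim_{r\to\infty}\frac{1}{h_r}\mathrm{card}(\{k\in I_r:\|s_k-L\|\ge\varepsilon\})=0$. A series $\sum_i z_i$ in $X$ is $S_\theta$-summable if its sequence of partial sums $s_k=\sum_{i=1}^k z_i$ is $S_\theta$-convergent to some $L\in X$. $\ell_\infty$ is the space of bounded real sequences and $c_0$ the space of real sequences converging to $0$. For a series $\sum_i x_i$ in $X$, $$S_{S_\theta}\Big(\sum_i x_i\Big)=\Big\{(a_i)_i\in\ell_\infty:\ \sum_i a_i x_i \text{ is } S_\theta\text{-summable}\Big\},$$ endowed with the supremum norm. A series $\sum_i x_i$ is weakly unconditionally Cauchy (wuC) if for every permutation $\pi$ of $\mathbb{N}$ the sequence $(\sum_{i=1}^n x_{\pi(i)})_n$ is weakly Cauchy; equivalently,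 $\sum_i|f(x_i)|<\infty$ for every $f\in X^*$. *)

(* Defs.v *)
From HB Require Import structures.
From mathcomp Require Import all_boot all_order all_algebra.
From mathcomp Require Import all_classical all_reals all_analysis.
Set Implicit Arguments.
Unset Strict Implicit.
Unset Printing Implicit Defensive.
Import Order.TTheory GRing.Theory Num.Theory.
Import numFieldNormedType.Exports.
Local Open Scope classical_set_scope.
Local Open Scope ring_scope.

(* Terms of sequences and series are indexed from 0, so that an informal series
   x_1 + x_2 + ... is x 0 + x 1 + ... here; its k-th partial sum is [series x k],
   the sum of the first k terms, for every k >= 1. The index r of theta is not
   shifted: the block I_r is the integer interval ]theta r.-1, theta r], and the
   value at r = 0 (an empty block) has no influence on the limits below. *)

Definition lac_length (theta : nat -> nat) (r : nat) : nat :=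
  (theta r - theta r.-1)%N.

Definition lac_block (theta : nat -> nat) (r : nat) : seq nat :=
  index_iota (theta r.-1).+1 (theta r).+1.

Definition lacunary (theta : nat -> nat) : Prop :=
  [/\ {homo theta : m n / (m < n)%N},
      theta 0 = 0%N &
      lac_length theta r @[r --> \oo] --> \oo].

Definition Stheta_cvg (R : realType) (X : normedModType R)
    (theta : nat -> nat) (s : nat -> X) (L : X) : Prop :=
  forall e : R, 0 < e ->
    (count (fun k => e <= `|s k - L|) (lac_block theta r))%:R
      / (lac_length theta r)%:R @[r --> \oo] --> (0 : R).

Definition Stheta_summable (R : realType) (X : normedModType R)
    (theta : nat -> nat) (z : nat -> X) : Prop :=
  exists L : X, Stheta_cvg theta (series z) L.

Definition l_infty (R : realType) : set (nat -> R) :=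
  [set a | bounded_fun a].

Definition c_zero (R : realType) : set (nat -> R) :=
  [set a | a n @[n --> \oo] --> (0 : R)].

Definition S_Stheta (R : realType) (X : normedModType R)
    (theta : nat -> nat) (x : nat -> X) : set (nat -> R) :=
  [set a | l_infty a /\ Stheta_summable theta (fun i => a i *: x i)].

(* The supremum norm; it is meaningful only on [l_infty]. *)
Definition sup_norm (R : realType) (a : nat -> R) : R :=
  sup (range (fun i => `|a i|)).

(* To be used for subsets of [l_infty] only. *)
Definition sup_norm_complete (R : realType) (S : set (nat -> R)) : Prop :=
  forall u : nat -> (nat -> R),
    (forall n, S (u n)) ->
    (forall e : R, 0 < e -> exists N : nat, forall m n : nat,
       (N <= m)%N -> (N <= n)%N -> sup_norm (u m \- u n) < e) ->
    exists a : nat -> R,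
      S a /\ sup_norm (u n \- a) @[n --> \oo] --> (0 : R).

Definition weakly_cauchy (R : realType) (X : normedModType R)
    (s : nat -> X) : Prop :=
  forall f : {linear X -> R^o}, continuous f -> cauchy (f (s n) @[n --> \oo]).

Definition wuC (R : realType) (X : normedModType R) (x : nat -> X) : Prop :=
  forall p : nat -> nat, bijective p -> weakly_cauchy (series (x \o p)).

(* Main.v *)
Require Import Defs.
From HB Require Import structures.
From mathcomp Require Import all_boot all_order all_algebra.
From mathcomp Require Import all_classical all_reals all_analysis.
From mathcomp Require Import ring lra.
Import Order.TTheory GRing.Theory Num.Theory.
Import numFieldNormedType.Exports.
Local Open Scope classical_set_scope.
Local Open Scope ring_scope.

(* A series is wuC iff the sums of the |f (x i)| are bounded for every
   continuous functional f, because a real series whose rearrangements all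
   converge is absolutely convergent. By Hahn-Banach and a gliding hump, the
   weakly bounded set of all partial sums of the series of a i *: x i with
   |a i| <= 1 is then norm bounded. Hence (1) implies (2): a uniformly
   convergent sequence in S gives uniformly close partial sums, so the
   S_theta-limits form a Cauchy sequence whose limit is the required S_theta-sum.
   (2) implies (3) because finitely supported sequences lie in S and are dense
   in c_0. For (3) implies (1), if the sums s_n of the |f (x i)| are unbounded,
   the multiplier a i = sg (f (x i)) / sqrt (1 + s_i) tends to 0, while f sends
   the partial sums of the series of a i *: x i to +oo, so that these are not
   S_theta-convergent. *)

Set Implicit Arguments.
Unset Strict Implicit.
Unset Printing Implicit Defensive.

(** * The Hahn-Banach theorem *)

Definition sublinear (R : realType) (V : lmodType R) (p : V -> R) : Prop :=
  (forall u v, p (u + v) <= p u + p v) /\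
  (forall (t : R) u, 0 <= t -> p (t *: u) = t * p u).

Lemma sublinear0 (R : realType) (V : lmodType R) (p : V -> R) :
  sublinear p -> p 0 = 0.
Proof. by case=> _ /(_ 0 0 (lexx _)); rewrite scale0r mul0r. Qed.

Lemma sublinear_geN (R : realType) (V : lmodType R) (p : V -> R) (v : V) :
  sublinear p -> - p (- v) <= p v.
Proof.
move=> sp; have := sublinear0 sp; case: sp => pD _ p0.
by have := pD v (- v); rewrite subrr p0; lra.
Qed.

(** Such pointwise infima produce both [lower_at] and the lower bounds of chains for Zorn's lemma.
    Homogeneity is asked only as an inequality for [0 < t]: using it for [t^-1] as well gives
    equality. *)
Lemma sublinear_inf (R : realType) (V : lmodType R) (F : set (V -> R)) :
  F !=set0 ->
  (forall v, has_lbound [set g v | g in F]) ->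
  (forall g1 g2 u v, F g1 -> F g2 ->
     exists2 g, F g & g (u + v) <= g1 u + g2 v) ->
  (forall g (t : R) v, F g -> 0 < t ->
     exists2 g', F g' & g' (t *: v) <= t * g v) ->
  (forall g, F g -> g 0 = 0) ->
  sublinear (fun v => inf [set g v | g in F]).
Proof.
move=> [g0 Fg0] lbF FD FZ F0.
pose q v := inf [set g v | g in F].
have qle g v : F g -> q v <= g v by move=> Fg; apply: ge_inf => //; exists g.
have q_ge v c : (forall g, F g -> c <= g v) -> c <= q v.
  by move=> h; apply: lb_le_inf => [|_ [g Fg <-]]; [exists (g0 v), g0 | exact: h].
have q0 : q 0 = 0.
  by apply/eqP; rewrite eq_le -{1}(F0 _ Fg0) qle //= q_ge // => g /F0 ->.
have qZ (t : R) v : 0 < t -> q (t *: v) <= t * q v.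
  move=> t0; rewrite -ler_pdivrMl //; apply: q_ge => g Fg.
  have [g' Fg' le_g'] := FZ _ t v Fg t0.
  by rewrite ler_pdivrMl // (le_trans (qle _ _ Fg')).
split=> [u v|t v].
- rewrite -lerBlDl; apply: (q_ge) => g2 Fg2; rewrite lerBlDr -lerBlDl.
  apply: (q_ge) => g1 Fg1; rewrite lerBlDr.
  have [g Fg le_g] := FD _ _ u v Fg1 Fg2.
  exact: le_trans (qle _ _ Fg) le_g.
- rewrite le_eqVlt => /predU1P[<-|t0]; first by rewrite scale0r mul0r.
  apply/eqP; rewrite eq_le; apply/andP; split; first exact: qZ.
  rewrite -ler_pdivlMl //; have := qZ t^-1 (t *: v).
  by rewrite invr_gt0 scalerA mulVf ?gt_eqF// scale1r; apply.
Qed.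

(* The largest sublinear functional below [q] whose value at [- y] is at most
   [- q y]: this is what forces a minimal sublinear functional to be odd. *)
Definition lower_at (R : realType) (V : lmodType R) (q : V -> R) (y v : V) : R :=
  inf [set g v | g in [set (fun v => q (v + t *: y) - t * q y) | t in [set t | 0 <= t]]].

(** By subadditivity every member of the family is at least [- q (- v)] at [v], so the infimum is
    finite. The member [t = 0] gives the bound by [q], and [t = 1] gives the value at [- y]. *)
Lemma lower_at_sublinear (R : realType) (V : lmodType R) (q : V -> R) (y : V) :
  sublinear q ->
  [/\ sublinear (lower_at q y), forall v, lower_at q y v <= q v
    & lower_at q y (- y) <= - q y].
Proof.
move=> sq; have q0 := sublinear0 sq; have [qD qZ] := sq.
have lb v : has_lbound [set g v | g in
    [set (fun v => q (v + t *: y) - t * q y) | t in [set t | 0 <= t]]].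
  exists (- q (- v)) => _ [_ [t /= t0 <-] <-].
  by have := qD (v + t *: y) (- v); rewrite [v + _ - v]addrAC subrr add0r qZ//; lra.
split.
- apply: sublinear_inf => //.
  + by exists (fun v => q (v + 0 *: y) - 0 * q y), 0 => //=.
  + move=> _ _ u v [s /= s0 <-] [t /= t0 <-].
    exists (fun v => q (v + (s + t) *: y) - (s + t) * q y).
      by exists (s + t) => //=; exact: addr_ge0.
    by have := qD (u + s *: y) (v + t *: y); rewrite scalerDl [u + _ + _]addrACA; lra.
  + move=> _ t v [s /= s0 <-] t0.
    exists (fun v => q (v + (t * s) *: y) - (t * s) * q y).
      by exists (t * s) => //=; rewrite mulr_ge0// ltW.
    by rewrite -scalerA -scalerDr qZ ?(ltW t0)// mulrBr mulrA.
  + by move=> _ [t /= t0 <-]; rewrite add0r qZ// subrr.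
- move=> v; apply: ge_inf => //.
  exists (fun v => q (v + 0 *: y) - 0 * q y); first by exists 0 => //=.
  by rewrite /= scale0r addr0 mul0r subr0.
- apply: ge_inf => //.
  exists (fun v => q (v + 1 *: y) - 1 * q y); first by exists 1 => //=.
  by rewrite /= scale1r addNr q0 mul1r sub0r.
Qed.

(** Zorn's lemma for the reversed pointwise order: a nonempty chain is bounded by its pointwise
    infimum, finite because every member is at least [- p (- v)] at [v]. *)
Lemma sublinear_minimal (R : realType) (V : lmodType R) (p : V -> R) :
  sublinear p ->
  exists q, [/\ sublinear q, forall v, q v <= p v
    & forall r, sublinear r -> (forall v, r v <= q v) -> r = q].
Proof.
move=> sp.
pose P (q : V -> R) := sublinear q /\ forall v, q v <= p v.
pose T := {q | P q}.
pose below (q r : T) := `[< forall v, sval r v <= sval q v >].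
have [| | |A totA|[q [sq qp]] qmin] := @Zorn T below.
- by move=> q; apply/asboolP.
- move=> q r s /asboolP qr /asboolP rs; apply/asboolP => v.
  exact: le_trans (rs v) (qr v).
- move=> [q hq] [r hr] /asboolP /= qr /asboolP /= rq; apply: eq_exist.
  by apply/funext => v; apply/eqP; rewrite eq_le qr rq.
- have [A0|/set0P[a0 Aa0]] := eqVneq A set0.
    by exists (exist P p (conj sp (fun=> lexx _))) => s; rewrite A0.
  pose F := [set sval q | q in A].
  have lbF v : has_lbound [set g v | g in F].
    exists (- p (- v)) => _ [_ [[g [sg gp]] _ <-] <-] /=.
    by apply: le_trans (sublinear_geN _ sg); rewrite lerN2.
  have sF : sublinear (fun v => inf [set g v | g in F]).
    apply: sublinear_inf => //.
    + by exists (sval a0), a0.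
    + move=> _ _ u v [a Aa <-] [b Ab <-].
      have [/asboolP ab|/asboolP ba] := totA _ _ Aa Ab.
        exists (sval b); first by exists b.
        by rewrite (le_trans ((svalP b).1.1 _ _))// lerD2r.
      exists (sval a); first by exists a.
      by rewrite (le_trans ((svalP a).1.1 _ _))// lerD2l.
    + move=> _ t v [a Aa <-] t0; exists (sval a); first by exists a.
      by rewrite (svalP a).1.2// ltW.
    + by move=> _ [a _ <-]; rewrite (sublinear0 (svalP a).1).
  have Fle a v : A a -> inf [set g v | g in F] <= sval a v.
    by move=> Aa; apply: ge_inf => //; exists (sval a) => //; exists a.
  have Fp v : inf [set g v | g in F] <= p v.
    exact: le_trans (Fle _ _ Aa0) ((svalP a0).2 v).
  exists (exist P _ (conj sF Fp)) => a Aa; apply/asboolP => v /=; exact: Fle.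
- exists q; split=> // r sr rq.
  have rp v : r v <= p v by exact: le_trans (rq v) (qp v).
  have /(congr1 sval) := qmin (exist P r (conj sr rp)) (asboolT rq).
  by [].
Qed.

(* A minimal sublinear functional is linear, and applying minimality to
   [lower_at p y] rather than to [p] fixes the value at [y]. *)
Theorem hahn_banach (R : realType) (V : lmodType R) (p : V -> R) (y : V) :
  sublinear p ->
  exists f : {linear V -> R^o}, (forall v, f v <= p v) /\ f y = p y.
Proof.
move=> sp; have [sp' p'p p'y] := lower_at_sublinear y sp.
have [q [sq qp' qmin]] := sublinear_minimal sp'.
have qN v : q (- v) = - q v.
  apply/eqP; rewrite eq_le; apply/andP; split.
    (* [lower_at q v] lies below [q], so minimality makes them equal, whence [q (- v) <= - q v]. *)
    have [sr rq rv] := lower_at_sublinear v sq.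
    by rewrite (qmin _ sr rq) in rv.
  by have := sublinear_geN v sq; lra.
have [qD qZ] := sq.
have qDE u v : q (u + v) = q u + q v.
  apply/eqP; rewrite eq_le qD /=.
  by have := qD (- u) (- v); rewrite -opprD !qN; lra.
have qL : linear (q : V -> R^o).
  move=> t u v; rewrite qDE; congr (_ + _).
  have [t0|t0] := leP 0 t; first exact: qZ.
  by rewrite -[t]opprK scaleNr qN qZ ?oppr_ge0 ?ltW// scaleNr.
pose qlin := GRing.isLinear.Build R V R^o *:%R q qL.
pose f : {linear V -> R^o} := HB.pack (q : V -> R^o) qlin.
exists f; split=> [v|]; first exact: le_trans (qp' v) (p'p v).
apply/eqP; rewrite eq_le (le_trans (qp' y) (p'p y)) /=.
by have := le_trans (qp' (- y)) p'y; rewrite qN lerN2.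
Qed.

(** * Weakly bounded sets are bounded *)

(** Hahn-Banach with the norm itself as sublinear functional; the bound at [- v] makes it
    two-sided. *)
Lemma norming_functional (R : realType) (X : normedModType R) (y : X) :
  exists f : {linear X -> R^o}, (forall v, `|f v| <= `|v|) /\ f y = `|y|.
Proof.
have snorm : sublinear (fun v : X => `|v|).
  by split=> [|t u t0]; [exact: ler_normD | rewrite normrZ ger0_norm].
have [f [fle fy]] := hahn_banach y snorm.
exists f; split=> // v; rewrite ler_norml fle andbT.
by have := fle (- v); rewrite linearN normrN lerNl.
Qed.

Lemma linear_le_continuous (R : realType) (X : normedModType R)
    (f : {linear X -> R^o}) (C : R) :
  (forall v, `|f v| <= C * `|v|) -> continuous f.
Proof.
move=> fC; apply/linear_bounded_continuous/linear_boundedP.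
near=> r => v; apply: le_trans (fC v) _; apply: ler_wpM2r => //.
Unshelve. all: by end_near. Qed.

Lemma geometric_increments_cvg (R : realType) (s : nat -> R) (c : R) :
  0 <= c -> (forall n, `|s n.+1 - s n| <= 3^-1 ^+ n * c) ->
  cvgn s /\ forall n, `|limn s - s n| <= 3 / 2 * (3^-1 ^+ n * c).
Proof.
(* [d n] is the tail sum of [3^-1 ^+ k * c] over [k >= n], so [s - d] is nondecreasing, [s + d] is
   nonincreasing, and the two squeeze the limit of [s]. *)
move=> c0 sE; pose d n : R := 3 / 2 * (3^-1 ^+ n * c).
have dS n : d n - d n.+1 = 3^-1 ^+ n * c by rewrite /d exprS; field.
have d0 n : 0 <= d n by rewrite /d !mulr_ge0// exprn_ge0.
have cvgd : d n @[n --> \oo] --> 0.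
  have : d n @[n --> \oo] --> 3 / 2 * (0 * c).
    apply: cvgM (cvg_cst _) (cvgM _ (cvg_cst _)); apply: cvg_expr.
    by rewrite ger0_norm// invf_lt1// ltr1n.
  by rewrite mul0r mulr0.
have ndl : {homo (fun n => s n - d n) : n m / (n <= m)%N >-> n <= m}.
  apply/nondecreasing_seqP => n.
  by have := sE n; have := dS n; rewrite ler_norml => ? /andP[]; lra.
have niu : {homo (fun n => s n + d n) : n m / (n <= m)%N >-> m <= n}.
  apply/nonincreasing_seqP => n.
  by have := sE n; have := dS n; rewrite ler_norml => ? /andP[]; lra.
have cvgl : cvgn (fun n => s n - d n).
  apply: nondecreasing_is_cvgn => //; exists (s 0%N + d 0%N) => _ [n _ <-].
  by have := niu _ _ (leq0n n); have := d0 n; lra.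
have sE' : s = (fun n => s n - d n) \+ d by apply/funext => n /=; rewrite subrK.
have cvgs : s n @[n --> \oo] --> limn (fun n => s n - d n).
  by rewrite {1}sE' -[limn _]addr0; apply: cvgD.
have lims : limn s = limn (fun n => s n - d n) by apply: cvg_lim.
split=> [|n]; first by apply/cvg_ex; eexists; exact: cvgs.
have := nondecreasing_cvgn_le ndl cvgl n; rewrite -lims => sl.
have : limn (fun n => s n + d n) = limn s.
  apply: cvg_lim => //; rewrite -[limn s]addr0; apply: cvgD => //.
  by rewrite lims.
have : cvgn (fun n => s n + d n).
  by apply/cvg_ex; eexists; apply: cvgD; [exact: cvgs|exact: cvgd].
move=> /(nonincreasing_cvgn_ge niu) /(_ n) + lE; rewrite lE => su.
by rewrite -/(d n) ler_norml; lra.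
Qed.

(* Gliding hump: if |y n| >= n * 3 ^ n on [A] and [h n] norms [y n], then for a
   suitable choice of signs the functional sum_n (+-) 3^-n *: h n is unbounded
   on the [y n], since its tail after n is too small to cancel the n-th term. *)
Theorem weakly_bounded_bounded (R : realType) (X : normedModType R) (A : set X) :
  (forall f : {linear X -> R^o}, continuous f ->
     exists C, forall y, A y -> `|f y| <= C) ->
  exists C, forall y, A y -> `|y| <= C.
Proof.
move=> wbA; apply: contrapT => nbA.
have /choice[y yP] n : exists y, A y /\ n%:R * 3 ^+ n <= `|y|.
  apply: contrapT => noy; apply: nbA; exists (n%:R * 3 ^+ n) => y Ay.
  by rewrite leNgt; apply/negP => lty; apply: noy; exists y; rewrite ltW.
have /choice[h hP] n := norming_functional (y n).
have h1 n v : `|h n v| <= `|v| by exact: (hP n).1.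
have hy n : h n (y n) = `|y n| by exact: (hP n).2.
(* The sign makes the new term agree with [g (y n)], so that the two cannot cancel at [y n]. *)
pose step n (g : X -> R) (v : X) : R :=
  g v + (-1) ^+ (g (y n) < 0)%R * (3^-1 ^+ n * h n v).
pose g := fix g n : X -> R := if n is m.+1 then step m (g m) else fun=> 0.
have gS n : g n.+1 = step n (g n) by [].
have gL n (t : R) u v : g n (t *: u + v) = t * g n u + g n v.
  elim: n => [|n IH]; first by rewrite /= mulr0 addr0.
  by rewrite gS /step IH linearP -[t *: h n u]/(t * h n u); ring.
have gd v n : `|g n.+1 v - g n v| <= 3^-1 ^+ n * `|v|.
  rewrite gS /step addrAC subrr add0r normrM normr_sign mul1r normrM.
  by rewrite ger0_norm ?exprn_ge0// ler_wpM2l ?exprn_ge0.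
have glim v := geometric_increments_cvg (normr_ge0 v) (gd v).
pose G v := limn (fun n => g n v).
have GL : linear (G : X -> R^o).
  move=> t u v; apply: cvg_lim => //=.
  rewrite (_ : (fun n => _) = (fun n => t * g n u + g n v)).
    by apply: cvgD (cvgM (cvg_cst _) _) _; exact: (glim _).1.
  by apply/funext => n; exact: gL.
pose flin := GRing.isLinear.Build R X R^o *:%R G GL.
pose f : {linear X -> R^o} := HB.pack (G : X -> R^o) flin.
have fcont : continuous f.
  apply: (@linear_le_continuous _ _ _ (3 / 2)) => v.
  by have := (glim v).2 0%N; rewrite expr0 mul1r /= subr0.
have [C fC] := wbA f fcont.
have fbig n : n%:R <= 2 * C.
  have [Ay yn] := yP n.
  (* The remainder after [g n.+1] is at most [3 / 2 * 3^-1 ^+ n.+1 * |y n|], which is half of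
     [3^-1 ^+ n * |y n|]. The other half survives, so [|G (y n)| >= n / 2]. *)
  have := (glim (y n)).2 n.+1; rewrite -/(G (y n)) => Gg.
  have gbig : 3^-1 ^+ n * `|y n| <= `|g n.+1 (y n)|.
    have p0 : 0 <= 3^-1 ^+ n * `|y n| by rewrite mulr_ge0// exprn_ge0.
    rewrite gS /step hy; have [g0|g0] := ltP.
      by rewrite expr1 mulN1r ler0_norm; lra.
    by rewrite expr0 mul1r ger0_norm; lra.
  have nle : n%:R <= 3^-1 ^+ n * `|y n|.
    by rewrite exprVn ler_pdivlMl ?exprn_gt0// mulrC.
  have := fC _ Ay; rewrite /= => GC.
  have := ler_normB (G (y n)) (G (y n) - g n.+1 (y n)).
  rewrite opprB addrCA subrr addr0.
  move: Gg; rewrite exprS -mulrA; lra.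
have := fbig (Num.truncn (2 * C)).+1.
by rewrite leNgt Num.Theory.truncnS_gt.
Qed.

(** * Unconditional convergence of real series *)

(** Later lists keep the entries of earlier ones, so together they define one function; [uniq] makes
    it injective and the covering hypothesis makes it surjective. *)
Lemma chain_permutation (L : nat -> seq nat) :
  (forall k, prefix (L k) (L k.+1)) -> (forall k, uniq (L k)) ->
  (forall k, (k <= size (L k))%N) -> (forall m, exists k, m \in L k) ->
  exists2 p : nat -> nat, bijective p
    & forall k i, (i < size (L k))%N -> p i = nth 0%N (L k) i.
Proof.
move=> Lpre Luniq Lsize Lcover.
have Lmono j k : (j <= k)%N -> prefix (L j) (L k).
  move=> /subnKC <-; elim: (k - j)%N => [|d IH]; first by rewrite addn0 prefix_refl.
  by rewrite addnS (prefix_trans IH).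
have Lnth j k i : (j <= k)%N -> (i < size (L j))%N ->
    nth 0%N (L k) i = nth 0%N (L j) i.
  by move=> /Lmono /prefixP[s ->] ij; rewrite nth_cat ij.
(* [L i.+1] has more than [i] entries, so the default [0%N] is never read. *)
pose p i := nth 0%N (L i.+1) i.
have pE k i : (i < size (L k))%N -> p i = nth 0%N (L k) i.
  move=> ik; rewrite /p; have [h|/ltnW h] := leqP k i.+1; last by rewrite (Lnth _ _ _ h).
  by rewrite (Lnth _ _ _ h).
exists p => //; rewrite -setTT_bijective; split=> //.
- move=> i j _ _.
  pose k := (maxn i j).+1.
  have ik : (i < size (L k))%N by rewrite (leq_trans _ (Lsize k))// ltnS leq_maxl.
  have jk : (j < size (L k))%N by rewrite (leq_trans _ (Lsize k))// ltnS leq_maxr.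
  by rewrite (pE k)// (pE k j)// => /eqP; rewrite nth_uniq// => /eqP.
- move=> m _; have [k mk] := Lcover m; exists (index m (L k)) => //.
  by rewrite (pE k) ?index_mem// nth_index.
Qed.

(* If the positive terms have infinite sum, listing within successive blocks of
   indices the positive terms first gives a rearrangement whose partial sums
   increase by more than 1 infinitely often. *)
Lemma unconditionally_cauchy_pos (R : realType) (c : nat -> R) :
  (forall p, bijective p -> cauchy (series (c \o p) n @[n --> \oo])) ->
  exists C : R, forall n, \sum_(0 <= i < n | 0 < c i) c i <= C.
Proof.
move=> cauchyc; apply: contrapT => nb.
(* [nx n] closes a block starting at [n] whose positive terms sum to more than 1; if there were
   none, the sums of positive terms would be bounded. *)
have /choice[nx nxP] n : exists m, 1 < \sum_(n <= i < m | 0 < c i) c i.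
  apply: contrapT => nm; apply: nb.
  exists (\sum_(0 <= i < n | 0 < c i) c i + 1) => m.
  have [nm'|mn] := leqP n m.
    rewrite (big_cat_nat (n := n))//= lerD2l leNgt; apply/negP => lt1.
    by apply: nm; exists m.
  rewrite [leRHS]addrC [in leRHS](big_cat_nat (n := m)) ?(ltnW mn)//= addrCA lerDl.
  by rewrite addr_ge0// sumr_ge0// => i /ltW.
have nx_gt n : (n < nx n)%N.
  rewrite ltnNge; apply/negP => nxn; have := nxP n.
  by rewrite big_geq// ltr10.
pose N k := iter k nx 0%N.
pose pos k := [seq i <- index_iota (N k) (N k.+1) | 0 < c i].
pose neg k := [seq i <- index_iota (N k) (N k.+1) | ~~ (0 < c i)].
pose L := fix L k := if k is j.+1 then L j ++ (pos j ++ neg j) else [::].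
have LS k : L k.+1 = L k ++ (pos k ++ neg k) by [].
have Lperm k : perm_eq (L k) (index_iota 0 (N k)).
  elim: k => [//|k IH]; rewrite LS.
  have -> : index_iota 0 (N k.+1) = index_iota 0 (N k) ++ index_iota (N k) (N k.+1).
    rewrite /index_iota !subn0 -iotaD subnKC//; exact: ltnW (nx_gt _).
  by apply: perm_cat => //; rewrite perm_filterC.
have Lsz k : size (L k) = N k by rewrite (perm_size (Lperm k)) size_iota subn0.
have Nk k : (k <= N k)%N by elim: k => // k IH; exact: leq_ltn_trans IH (nx_gt _).
have [|||m|p pbij pE] := @chain_permutation L.
- by move=> k; rewrite LS prefix_prefix.
- by move=> k; rewrite (perm_uniq (Lperm k)) iota_uniq.
- by move=> k; rewrite Lsz.
- exists m.+1; rewrite (perm_mem (Lperm _)) mem_index_iota; exact: (Nk m.+1).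
have /cauchy_seriesP /(_ _ ltr01) [[A B] [[a _ aA] [b _ bB]] AB] := cauchyc p pbij.
(* In the rearrangement the positive terms of block [k] occupy the positions from [N k] to [m], so
   the partial sums at these two places differ by more than 1. *)
pose k := maxn a b; pose m := (N k + size (pos k))%N.
have kA : A (N k) by apply: aA => /=; rewrite (leq_trans _ (Nk k))// leq_maxl.
have mB : B m.
  by apply: bB => /=; rewrite (leq_trans _ (leq_addr _ _))// (leq_trans _ (Nk k))// leq_maxr.
have := AB (N k, m) (conj kA mB); apply/negP; rewrite -leNgt /=.
suff -> : \sum_(N k <= i < m) (c \o p) i = \sum_(i <- pos k) c i.
  by rewrite big_filter; apply: le_trans (ler_norm _); exact/ltW/nxP.
rewrite -{1}(add0n (N k)) big_addn /m addKn [RHS](big_nth 0%N).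
apply: eq_big_nat => i /andP[_ isz] /=; congr (c _).
rewrite (pE k.+1) LS.
  by rewrite nth_cat Lsz ltnNge leq_addl /= addnK nth_cat isz.
by rewrite !size_cat Lsz addnC ltn_add2l (leq_trans isz)// leq_addr.
Qed.

(** The absolute value is the sum of the positive parts of [c] and [- c], and both sequences satisfy
    the hypothesis. *)
Lemma unconditionally_cauchy_abs (R : realType) (c : nat -> R) :
  (forall p, bijective p -> cauchy (series (c \o p) n @[n --> \oo])) ->
  exists C : R, forall n, \sum_(0 <= i < n) `|c i| <= C.
Proof.
move=> cauchyc.
have [C1 hC1] := unconditionally_cauchy_pos cauchyc.
have [|C2 hC2] := @unconditionally_cauchy_pos _ (- c).
  move=> p /cauchyc /cauchy_cvgP; rewrite -is_cvg_seriesN => h.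
  by apply/cauchy_cvgP.
exists (C1 + C2) => n; apply: le_trans (lerD (hC1 n) (hC2 n)).
rewrite (big_mkcond (fun i => 0 < c i)) (big_mkcond (fun i => 0 < (- c) i)) -big_split /=.
apply: ler_sum => i _; rewrite !fctE oppr_gt0.
by have [] := ltrgtP (c i) 0 => ci; rewrite ?ci ?addr0 ?add0r ?normr0 //;
  [rewrite ltr0_norm | rewrite gtr0_norm].
Qed.

(** As [p] is injective, each rearranged sum of absolute values is a subsum of an initial one, hence
    at most [C]; the rearranged series thus converges absolutely. *)
Lemma abs_bounded_unconditionally_cauchy (R : realType) (c : nat -> R) (C : R)
    (p : nat -> nat) :
  (forall n, \sum_(0 <= i < n) `|c i| <= C) -> injective p ->
  cauchy (series (c \o p) n @[n --> \oo]).
Proof.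
move=> cC pinj; apply/cauchy_cvgP/(@normed_cvg R R^o).
apply: nondecreasing_is_cvgn.
  apply/nondecreasing_seqP => n.
  by rewrite /= seriesSr lerDl.
exists C => _ [n _ <-] /=; rewrite /series /=.
have -> : \sum_(0 <= i < n) `|c (p i)| = \sum_(j <- map p (index_iota 0 n)) `|c j|.
  by rewrite big_map.
set s := map _ _.
pose M := \max_(j <- s) j.+1.
apply: le_trans (cC M).
have us : uniq s by rewrite map_inj_uniq// iota_uniq.
have ps : perm_eq s [seq j <- index_iota 0 M | j \in s].
  apply: uniq_perm => //; first by rewrite filter_uniq// iota_uniq.
  move=> j; rewrite mem_filter mem_index_iota /=.
  have [js|//] := boolP (j \in s).
  by rewrite (@leq_bigmax_seq nat s xpredT succn j js isT).
by rewrite (perm_big _ ps) big_filter big_mkcond; apply: ler_sum => j _; case: ifP.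
Qed.

Lemma unbounded_multiplier (R : realType) (c : nat -> R) :
  (~ exists C : R, forall n, \sum_(0 <= i < n) `|c i| <= C) ->
  exists2 a : nat -> R, a n @[n --> \oo] --> 0
    & series (fun i => a i * c i) n @[n --> \oo] --> +oo.
Proof.
move=> nb.
pose S n : R := \sum_(0 <= i < n) `|c i|.
have S0 n : 0 <= S n by apply: sumr_ge0.
have Smono : {homo S : n m / (n <= m)%N >-> n <= m}.
  by apply/nondecreasing_seqP => n; rewrite /S big_nat_recr//= lerDl.
have Spinf : S n @[n --> \oo] --> +oo.
  apply: nondecreasing_dvgn_lt => // /cvg_seq_bounded.
  move=> /pinfty_ex_gt0[M _ hM]; apply: nb; exists M => n.
  exact: le_trans (ler_norm _) (hM n I).
pose w n : R := Num.sqrt (1 + S n).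
have w0 n : 0 < w n by rewrite sqrtr_gt0 ltr_pwDl.
have w2 n : w n ^+ 2 = 1 + S n by rewrite sqr_sqrtr// addr_ge0.
have wmono n m : (n <= m)%N -> w n <= w m.
  by move=> nm; rewrite ler_wsqrtr// lerD2l Smono.
have wpinf : w n @[n --> \oo] --> +oo.
  apply/cvgryPge => B; move/cvgryPge : Spinf => /(_ (B ^+ 2)).
  apply: filterS => n BS; apply: le_trans (ler_norm B) _.
  rewrite -(@ler_pXn2r _ 2) ?nnegrE ?(ltW (w0 n))//.
  by rewrite real_normK ?num_real// w2; lra.
exists (fun i => Num.sg (c i) / w i).
  apply/cvgrPdist_le => e e0; move/cvgryPge : wpinf => /(_ e^-1).
  apply: filterS => n ew; rewrite sub0r normrN normrM normfV (gtr0_norm (w0 n)).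
  rewrite ler_pdivrMr//; apply: (@le_trans _ _ 1); last by rewrite mulrC -ler_pdivrMr// mul1r.
  by rewrite normr_sg; case: (c n != 0).
(* Replacing each [w i] by the larger [w n] bounds the series below by [S n / w n], which is
   [w n - 1 / w n] because [S n = w n ^+ 2 - 1]. *)
have lower n : w n - 1 <= series (fun i => Num.sg (c i) / w i * c i) n.
  have Sw : w n - 1 <= S n / w n.
    rewrite ler_pdivlMr// mulrBl mul1r -expr2 w2.
    suff : 1 <= w n by lra.
    by rewrite -sqrtr1 ler_wsqrtr// lerDl.
  apply: le_trans Sw _; rewrite /series /= /S mulr_suml.
  apply: ler_sum_nat => i /andP[_ iltn].
  rewrite mulrAC -normrEsg ler_wpM2l// lef_pV2 ?posrE//.
  exact: wmono (ltnW iltn).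
apply/cvgryPge => B; move/cvgryPge : wpinf => /(_ (B + 1)).
by apply: filterS => n Bw; apply: le_trans (lower n); rewrite lerBrDr.
Qed.

(** * Lacunary statistical convergence *)

(** Late blocks contain only large indices, because strict monotonicity gives
    [r.-1 <= theta r.-1]. *)
Lemma lac_block_ge (theta : nat -> nat) (r k : nat) :
  lacunary theta -> k \in lac_block theta r -> (r <= k)%N.
Proof.
case=> thetaS _ _; rewrite mem_index_iota => /andP[+ _].
case: r => [//|r] /=; apply: leq_ltn_trans.
by elim: r => // r IH; exact: leq_ltn_trans IH (thetaS _ _ (ltnSn r)).
Qed.

(** In a late block each of the two exceptional sets has less than half of the indices, so together
    they cannot cover it. *)
Lemma Stheta_cvg_common (R : realType) (X Y : normedModType R)
    (theta : nat -> nat) (s : nat -> X) (t : nat -> Y) (K : X) (L : Y) (e : R)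
    (N : nat) :
  lacunary theta -> Stheta_cvg theta s K -> Stheta_cvg theta t L -> 0 < e ->
  exists k, [/\ (N <= k)%N, `|s k - K| < e & `|t k - L| < e].
Proof.
move=> lac sK tL e0; have [_ _ /cvgnyPgt /(_ 0%N) len_gt0] := lac.
have half0 : 0 < 2^-1 :> R by [].
have /cvgrPdist_lt /(_ _ half0) sK2 := sK e e0.
have /cvgrPdist_lt /(_ _ half0) tL2 := tL e e0.
pose bs k := e <= `|s k - K|; pose bt k := e <= `|t k - L|.
near \oo => r.
have Nr : (N <= r)%N by near: r; exact: nbhs_infty_ge.
have l0 : 0 < (lac_length theta r)%:R :> R by rewrite ltr0n; near: r.
have hs : `|0 - (count bs (lac_block theta r))%:R / (lac_length theta r)%:R|
    < 2^-1 :> R by near: r.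
have ht : `|0 - (count bt (lac_block theta r))%:R / (lac_length theta r)%:R|
    < 2^-1 :> R by near: r.
apply: contrapT => nk.
have : (lac_length theta r <= count bs (lac_block theta r)
     + count bt (lac_block theta r))%N.
  rewrite -count_predUI (leq_trans _ (leq_addr _ _))//.
  suff : all (predU bs bt) (lac_block theta r).
    by rewrite all_count => /eqP ->; rewrite size_iota subSS.
  apply/allP => k kr /=; rewrite /bs /bt !leNgt -negb_and.
  apply/negP => /andP[sk tk]; apply: nk.
  by exists k; split=> //; exact: leq_trans Nr (lac_block_ge lac kr).
move: hs ht; rewrite !sub0r !normrN !ger0_norm ?divr_ge0// !ltr_pdivrMr//.
by rewrite -(ler_nat R) natrD; lra.
Unshelve. all: by end_near. Qed.

Lemma Stheta_lim_dist (R : realType) (X : normedModType R) (theta : nat -> nat)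
    (s t : nat -> X) (K L : X) (B : R) :
  lacunary theta -> Stheta_cvg theta s K -> Stheta_cvg theta t L ->
  (forall k, `|s k - t k| <= B) -> `|K - L| <= B.
Proof.
move=> lac sK tL stB; apply/ler_addgt0Pr => e e0.
have e2 : 0 < e / 2 by rewrite divr_gt0.
have [k [_ ks kt]] := Stheta_cvg_common 0 lac sK tL e2.
have -> : K - L = (s k - t k) - (s k - K) + (t k - L).
  by rewrite opprB [s k - t k + _]addrC !addrA !subrK.
have := stB k; have := ler_normD (s k - t k - (s k - K)) (t k - L).
have := ler_normB (s k - t k) (s k - K); lra.
Qed.

Lemma Stheta_cvg_near_cst (R : realType) (X : normedModType R)
    (theta : nat -> nat) (s : nat -> X) (L : X) (N : nat) :
  lacunary theta -> (forall k, (N <= k)%N -> s k = L) -> Stheta_cvg theta s L.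
Proof.
move=> lac sL e e0; apply: cvg_near_cst; near=> r.
have Nr : (N <= r)%N by near: r; exact: nbhs_infty_ge.
rewrite (@eq_in_count _ _ pred0) ?count_pred0 ?mul0r// => k kr.
by rewrite sL ?(leq_trans Nr (lac_block_ge lac kr))// subrr normr0 leNgt e0.
Unshelve. all: by end_near. Qed.

(** With [e] split in three, [e <= |t k - L|] forces [e / 3 <= |s k - K|], so the exceptional set of
    [t] lies in one of [s], whose density in the blocks tends to 0. *)
Lemma Stheta_cvg_approx (R : realType) (X : normedModType R)
    (theta : nat -> nat) (t : nat -> X) (L : X) :
  (forall e : R, 0 < e -> exists s K, [/\ Stheta_cvg theta s K,
     forall k, `|s k - t k| <= e & `|K - L| <= e]) ->
  Stheta_cvg theta t L.
Proof.
move=> approx e e0; have e3 : 0 < e / 3 by rewrite divr_gt0.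
have [s [K [sK st KL]]] := approx _ e3.
apply: (squeeze_cvgr _ (cvg_cst 0) (sK _ e3)).
apply: nearW => r; rewrite divr_ge0//= ler_wpM2r ?invr_ge0// ler_nat.
apply: sub_count => k /= tke.
have -> : s k - K = (t k - L) - (t k - s k) - (K - L).
  by rewrite !opprB [t k - L + _]addrC !addrA !subrK.
have := st k; rewrite distrC.
have := lerB_normD (t k - L - (t k - s k)) (- (K - L)).
have := lerB_dist (t k - L) (t k - s k).
have := lerB_dist (t k - L - (t k - s k)) (K - L).
lra.
Qed.

(** * Bounded sequences and the supremum norm *)

Lemma l_inftyP (R : realType) (a : nat -> R) :
  l_infty a <-> exists C, forall i, `|a i| <= C.
Proof.
split=> [/pinfty_ex_gt0[C _ aC]|[C aC]]; first by exists C => i; exact: aC.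
exists C; split=> [|M /ltW CM i _]; [exact: num_real|exact: le_trans (aC i) CM].
Qed.

Lemma sup_norm_ge (R : realType) (a : nat -> R) (i : nat) :
  l_infty a -> `|a i| <= sup_norm a.
Proof.
move=> /l_inftyP[C aC]; apply: ub_le_sup; last by exists i.
by exists C => _ [j _ <-].
Qed.

Lemma sup_norm_le (R : realType) (a : nat -> R) (C : R) :
  (forall i, `|a i| <= C) -> sup_norm a <= C.
Proof.
move=> aC; apply: ge_sup => [|_ [i _ <-] //]; by exists `|a 0%N|, 0%N.
Qed.

Lemma l_inftyB (R : realType) (a b : nat -> R) :
  l_infty a -> l_infty b -> l_infty (a \- b).
Proof.
move=> /l_inftyP[A aA] /l_inftyP[B bB]; apply/l_inftyP; exists (A + B) => i /=.
by apply: le_trans (ler_normB _ _) _; exact: lerD.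
Qed.

Lemma linear_continuous_le (R : realType) (X : normedModType R)
    (f : {linear X -> R^o}) :
  continuous f -> exists2 M : R, 0 < M & forall v, `|f v| <= M * `|v|.
Proof. by move=> /linear_bounded_continuous/linear_boundedP/pinfty_ex_gt0. Qed.

(** * Weakly unconditionally Cauchy series *)

Lemma wuC_abs (R : realType) (X : normedModType R) (x : nat -> X) :
  wuC x <-> forall f : {linear X -> R^o}, continuous f ->
    exists C : R, forall n, \sum_(0 <= i < n) `|f (x i)| <= C.
Proof.
have fS (f : {linear X -> R^o}) p :
    (fun n => f (series (x \o p) n)) = series ((f \o x) \o p).
  by apply/funext => n; rewrite /series /= linear_sum.
split=> [wx f fc|ab p pbij f fc].
  apply: (@unconditionally_cauchy_abs R (f \o x)) => p pbij.
  by rewrite -fS; exact: wx.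
have [C fC] := ab f fc; rewrite fS.
exact: (@abs_bounded_unconditionally_cauchy R (f \o x) C p fC (bij_inj pbij)).
Qed.

(** The bound is uniform in [a] and [n]: partial sums depend on the multiplier in a Lipschitz way
    for the supremum norm, which is what completeness rests on. *)
Lemma wuC_bound (R : realType) (X : normedModType R) (x : nat -> X) :
  wuC x -> exists H : R, forall (a : nat -> R) (B : R) (n : nat),
    (forall i, `|a i| <= B) -> `|series (fun i => a i *: x i) n| <= H * B.
Proof.
move=> /wuC_abs absx.
pose A : set X := [set y | exists a n, (forall i, `|a i| <= 1 :> R) /\
  y = series (fun i => a i *: x i) n].
have [f fc|H HA] := @weakly_bounded_bounded R X A.
  have [C fC] := absx f fc; exists C => _ [a [n [a1 ->]]].
  apply: le_trans (fC n); rewrite /series /= linear_sum.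
  apply: le_trans (ler_norm_sum _ _ _) _; apply: ler_sum => i _.
  by rewrite linearZ normrM ler_piMl.
exists H => a B n aB.
have : 0 <= B by exact: le_trans (normr_ge0 _) (aB 0%N).
(* The reduction to multipliers bounded by 1 divides by [B]; for [B = 0] all terms vanish. *)
rewrite le_eqVlt => /predU1P[B0|B0].
  rewrite -B0 mulr0 /series /= big1 ?normr0// => i _.
  by have := aB i; rewrite -B0 normr_le0 => /eqP ->; rewrite scale0r.
have -> : series (fun i => a i *: x i) n = B *: series (fun i => (B^-1 * a i) *: x i) n.
  rewrite /series /= scaler_sumr; apply: eq_bigr => i _.
  by rewrite scalerA mulVKf ?gt_eqF.
rewrite normrZ gtr0_norm// mulrC; apply: ler_wpM2r; first exact: ltW.
apply: HA; exists (fun i => B^-1 * a i), n; split=> // i.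
by rewrite normrM gtr0_norm ?invr_gt0// ler_pdivrMl// mulr1.
Qed.

(** * The three implications *)

Lemma wuC_complete (R : realType) (X : completeNormedModType R) (x : nat -> X)
    (theta : nat -> nat) :
  lacunary theta -> wuC x -> sup_norm_complete (S_Stheta theta x).
Proof.
move=> lac /wuC_bound[H0 hH0] u Su ucauchy.
(* The maximum with 1 makes [H] positive, so that tolerances can be divided by it. *)
pose H := Num.max H0 1.
have H1 : 0 < H by rewrite lt_max ltr01 orbT.
have hH (a : nat -> R) B n : (forall i, `|a i| <= B) ->
    `|series (fun i => a i *: x i) n| <= H * B.
  move=> aB; apply: le_trans (hH0 a B n aB) _; apply: ler_wpM2r.
    exact: le_trans (normr_ge0 _) (aB 0%N).
  by rewrite le_max lexx.
have seriesB (a b : nat -> R) k : series (fun i => a i *: x i) k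
    - series (fun i => b i *: x i) k = series (fun i => (a i - b i) *: x i) k.
  by rewrite /series /= -sumrB; apply: eq_bigr => i _; rewrite scalerBl.
have ubd n : l_infty (u n) by exact: (Su n).1.
have uc e : 0 < e -> exists N, forall m n i, (N <= m)%N -> (N <= n)%N ->
    `|u m i - u n i| < e.
  move=> /ucauchy[N hN]; exists N => m n i Nm Nn.
  apply: le_lt_trans (hN m n Nm Nn).
  by apply: (@sup_norm_ge _ (u m \- u n)); exact: l_inftyB.
have cauchy_cvg (Y : completeNormedModType R) (v : nat -> Y) :
    (forall e, 0 < e -> exists N, forall m n, (N <= m)%N -> (N <= n)%N ->
      `|v m - v n| < e) -> cvgn v.
  move=> vc; apply/cauchy_cvgP/cauchy_exP => e e0.
  have [N hN] := vc e e0; exists (v N); exists N => // n /= Nn.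
  by rewrite -ball_normE /=; exact: hN.
pose a i := limn (fun n => u n i).
have uai i : u n i @[n --> \oo] --> a i.
  apply: (cauchy_cvg R^o) => e /uc[N hN]; exists N => m n; exact: hN.
have ua e : 0 < e -> exists N, forall n i, (N <= n)%N -> `|u n i - a i| <= e.
  move=> /uc[N hN]; exists N => n i Nn.
  (* Letting [m] tend to infinity keeps the threshold [N] independent of [i]. *)
  have : `|u n i - u m i| @[m --> \oo] --> `|u n i - a i|.
    by apply: cvg_norm; apply: cvgB; [exact: cvg_cst|exact: uai].
  move=> /cvgr_to_le; apply; near=> m; apply/ltW/hN => //.
  by near: m; exact: nbhs_infty_ge.
have /choice[L sL] n := (Su n).2.
(* Partial sums for [u m] and [u n] stay within [H * (e / (2 * H)) = e / 2] of each other, and the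
   bound passes to the limits [L m] and [L n]; completeness of [X] then makes [L] converge. *)
have /(cauchy_cvg X) cvgL : forall e, 0 < e -> exists N, forall m n,
    (N <= m)%N -> (N <= n)%N -> `|L m - L n| < e.
  move=> e e0; have e2 : 0 < e / (2 * H) by rewrite divr_gt0// mulr_gt0.
  have [N hN] := uc _ e2; exists N => m n Nm Nn.
  apply: (@le_lt_trans _ _ (H * (e / (2 * H)))).
    apply: (Stheta_lim_dist lac (sL m) (sL n)) => k.
    by rewrite seriesB; apply: hH => i; exact/ltW/hN.
  by rewrite (_ : H * _ = e / 2); [lra | field; rewrite gt_eqF].
exists a; split; first split.
- have [N hN] := ua 1 ltr01; have /l_inftyP[C uC] := ubd N.
  apply/l_inftyP; exists (C + 1) => i; rewrite -[a i](subKr (u N i)).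
  by apply: le_trans (ler_normB _ _) _; rewrite lerD// hN.
- exists (limn L); apply: Stheta_cvg_approx => e e0.
  have eH : 0 < e / H by rewrite divr_gt0.
  have [N hN] := ua _ eH.
  have /cvgrPdist_le /(_ _ e0) [M _ hM] := cvgL.
  pose n := maxn N M; exists (series (fun i => u n i *: x i)), (L n); split.
  + exact: sL.
  + move=> k; rewrite seriesB (le_trans (hH _ (e / H) _ _))//.
      by move=> i; apply: hN; rewrite leq_maxl.
    by rewrite mulrC divfK ?gt_eqF.
  + by rewrite distrC; apply: hM; rewrite /= leq_maxr.
- apply/cvgrPdist_le => e /ua[N hN]; exists N => // n /= Nn.
  rewrite sub0r normrN ger0_norm.
    by apply: sup_norm_le => i; exact: hN.
  apply: le_trans (normr_ge0 ((u n \- a) 0%N)) _; apply: sup_norm_ge.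
  by apply/l_inftyP; exists e => i; exact: hN.
Unshelve. all: by end_near. Qed.

Lemma complete_c_zero (R : realType) (X : normedModType R) (x : nat -> X)
    (theta : nat -> nat) :
  lacunary theta -> sup_norm_complete (S_Stheta theta x) ->
  @c_zero R `<=` S_Stheta theta x.
Proof.
move=> lac complete a a0.
pose u n i := if (i < n)%N then a i else 0.
have tail e : 0 < e -> exists N, forall i, (N <= i)%N -> `|a i| <= e.
  move=> e0; have /cvgrPdist_le /(_ _ e0)[N _ hN] := a0.
  by exists N => i Ni; have := hN i Ni; rewrite sub0r normrN.
have abd : l_infty a by apply: cvg_seq_bounded; apply/cvg_ex; exists 0.
have Su n : S_Stheta theta x (u n).
  split.
    have /l_inftyP[C aC] := abd; apply/l_inftyP; exists C => i; rewrite /u.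
    by case: ifP => // _; rewrite normr0 (le_trans _ (aC 0%N)).
  exists (series (fun i => u n i *: x i) n).
  apply: (@Stheta_cvg_near_cst _ _ _ _ _ n) => // k nk.
  rewrite /series /= (big_cat_nat (n := n))//= [X in _ + X]big_nat_cond.
  rewrite [X in _ + X]big1 ?addr0//.
  by move=> i; rewrite andbT => /andP[ni _]; rewrite /u ltnNge ni scale0r.
have [|b [Sb ub]] := complete u Su.
  move=> e e0; have e2 : 0 < e / 2 by rewrite divr_gt0.
  have [N hN] := tail _ e2; exists N => m n Nm Nn.
  apply: (@le_lt_trans _ _ (e / 2)); last by lra.
  apply: sup_norm_le => i; rewrite /= /u.
  have [iN|/hN ai] := ltnP i N.
    by rewrite (leq_trans iN Nm) (leq_trans iN Nn) subrr normr0 (ltW e2).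
  by do 2?case: ifP => _; rewrite ?subrr ?subr0 ?sub0r ?normrN ?normr0 ?(ltW e2).
(* The limit [b] is identified coordinatewise: once [i < n], [u n i] is [a i], so [|a i - b i|] is
   at most the supremum norm of [u n \- b]. *)
suff -> : a = b by [].
apply/funext => i; apply/eqP; rewrite -subr_eq0 -normr_le0.
apply/ler_addgt0Pr => e e0; rewrite add0r.
have /cvgrPdist_le /(_ _ e0)[N _ hN] := ub.
pose n := maxn N i.+1.
have := hN n (leq_maxl _ _); rewrite sub0r normrN => /(le_trans (ler_norm _)).
apply: le_trans.
have -> : a i = u n i by rewrite /u leq_maxr.
apply: (@sup_norm_ge _ (u n \- b)); apply: l_inftyB; first exact: (Su n).1.
exact: Sb.1.
Qed.

Lemma c_zero_wuC (R : realType) (X : normedModType R) (x : nat -> X)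
    (theta : nat -> nat) :
  lacunary theta -> @c_zero R `<=` S_Stheta theta x -> wuC x.
Proof.
move=> lac c0S; apply/wuC_abs => f fc; apply: contrapT => /unbounded_multiplier.
move=> [a /c0S[_ [L sL]] /cvgryPgt acinf].
have [M M0 fM] := linear_continuous_le fc.
(* [f L + M] bounds [f] on the unit ball around [L], so a partial sum in that ball with index past
   [N] contradicts the divergence. Such an index comes from using the same sequence twice in
   [Stheta_cvg_common]. *)
have [N _ hN] := acinf (f L + M).
have [k [Nk kL _]] := Stheta_cvg_common N lac sL sL ltr01.
have := hN k Nk; rewrite /=.
have -> : series (fun i => a i * f (x i)) k = f (series (fun i => a i *: x i) k).
  by rewrite /series /= linear_sum; apply: eq_bigr => i _; rewrite linearZ.
apply/negP; rewrite -leNgt -lerBlDl -linearB.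
apply: le_trans (ler_norm _) _; apply: le_trans (fM _) _.
by rewrite -[leRHS]mulr1 ler_wpM2l ?ltW.
Qed.

Theorem theorem3p1 (R : realType) (X : completeNormedModType R)
    (x : nat -> X) (theta : nat -> nat) (htheta : lacunary theta) :
  (wuC x <-> sup_norm_complete (S_Stheta theta x)) /\
  (sup_norm_complete (S_Stheta theta x) <-> @c_zero R `<=` S_Stheta theta x).
Proof.
have h12 : wuC x -> sup_norm_complete (S_Stheta theta x) by exact: wuC_complete.
have h23 : sup_norm_complete (S_Stheta theta x) -> @c_zero R `<=` S_Stheta theta x.
  exact: complete_c_zero.
have h31 : @c_zero R `<=` S_Stheta theta x -> wuC x by exact: c_zero_wuC.
split; split=> h.
- exact: h12.
- exact: h31 (h23 h).
- exact: h23.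
- exact: h12 (h31 h).
Qed.
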